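(* Let $k$ be a field, $Q$ a finite quiver with finite vertex set $P$, $\mathcal{C}$ the small category freely generated by $Q$, $k\mathcal{C}$ its category algebra (equal to the path algebra $kQ$), and $N$ a left $k\mathcal{C}$-module. Let $\tilde{D}=\pi_{\mathcal{C}}(N)\circ t$ be the natural system on $\mathcal{C}$ given by $\tilde D_{\alpha}=\mathrm{id}_{t(\alpha)}\cdot N$ for each morphism $\alpha$ of $\mathcal{C}$, where a morphism $(u,v)$ of the category of factorizations acts as left multiplication by $u$. Let $T=((a_i)_{i=1}^{l};(b_i)_{i=1}^{m};(f_i)_{i=1}^{l};(g_i)_{i=1}^{n};(h_i)_{i=1}^{r})$ be an output of Algorithm A (defined in the context) for $Q$, and let $(V,W)$ be the output of Algorithm B (defined in the context) for $T$, so that $V=(v_{i,j})$ is an $(l+n+r)\times l$ matrix and $W=(w_{i,j})$ an $(l+n+r)\times m$ matrix with entries in $k\mathcal{C}$. Let $v_j$ and $w_j$ denote the $j$-th columns of $V$ and $W$. Put $$A_1=\bigoplus_{i=1}^{l}\tilde D_{f_i},\qquad A_2=\bigoplus_{i=1}^{n}\tilde D_{g_i},\qquad A_3=\bigoplus_{i=1}^{r}\tilde D_{h_i},$$ and let $\bar V,\bar W\subseteq A_1\oplus A_2\oplus A_3$ be the $k$-linear spans $$\bar V=\langle v_j n_{a_j} \mid n_{a_j}\in \mathrm{id}_{a_j}\cdot N,\ 1\le j\le l\rangle,\qquad \bar W=\langle w_j n_{b_j}\mid n_{b_j}\in \mathrm{id}_{b_j}\cdot N,\ 1\le j\le m\rangle,$$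 where $v_jn=(v_{i,j}n)_{1\le i\le l+n+r}$ and $w_jn=(w_{i,j}n)_{1\le i\le l+n+r}$, the coordinates $1,\dots,l$ being those of $A_1$, the next $n$ those of $A_2$, and the last $r$ those of $A_3$. Then the first Baues--Wirsching cohomology satisfies $$\mathrm{H}^1_{BW}(\mathcal{C},\tilde D)\;\cong\;(A_1\oplus A_2\oplus A_3)/(\bar V+\bar W)$$ as $k$-vector spaces.
   Context: **Quivers.** A finite quiver is a finite set $Q$ of arrows with a finite set $P$ of vertices and maps $s,t:Q\to P$ (source, target). A path of length $\ell$ is a sequence $f_1\cdots f_\ell$ of arrows with $s(f_i)=t(f_{i+1})$ for all $i$; it goes from $s(f_\ell)$ to $t(f_1)$. For each vertex $x$ there is also a path $\mathrm{id}_x$ of length $0$ from $x$ to $x$. A cycle is a path of positive length $f_1\cdots f_\ell$ with $t(f_1)=s(f_\ell)$. A quiver is acyclic if it has no cycle. A subset of $Q$ is regarded as a subquiver with vertex set $P$. ''A path in $Q_1$'' (for $Q_1\subseteq Q$) means a path all of whose arrows lie in $Q_1$; length $0$ is allowed. **Free category and category algebra.** The small category $\mathcal{C}$ freely generated by $Q$ has object set $P$, morphisms $x\to y$ the paths from $x$ to $y$, composition the concatenation of paths, and identities $\mathrm{id}_x$. The category algebra $k\mathcal{C}$ has the morphisms of $\mathcal{C}$ as $k$-basis, with product the composition, or $0$ if the morphisms are not composable. **Natural systems.** The category of factorizations $\mathcal{F}(\mathcal{C})$ has as objects the morphisms of $\mathcal{C}$; a morphism $\alpha\to\beta$ is a pair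 $(u,v)$ of morphisms of $\mathcal{C}$ with $\beta=u\circ\alpha\circ v$; composition is $(u',v')\circ(u,v)=(u'\circ u,v\circ v')$. A natural system on $\mathcal{C}$ is a covariant functor $D:\mathcal{F}(\mathcal{C})\to k\text{-}\mathrm{Mod}$, $\alpha\mapsto D_\alpha$. For composable $u,v$ (with $u\circ v$ defined) write $u_*=D(u,\mathrm{id}_{s(v)}):D_v\to D_{u\circ v}$ and $v^*=D(\mathrm{id}_{t(u)},v):D_u\to D_{u\circ v}$. The target functor $t:\mathcal{F}(\mathcal{C})\to\mathcal{C}$ sends $\alpha$ to its target $t(\alpha)$ and $(u,v)$ to $u$. For a left $k\mathcal{C}$-module $N$, $\pi_{\mathcal{C}}(N):\mathcal{C}\to k\text{-}\mathrm{Mod}$ sends $x$ to $\mathrm{id}_x\cdot N$ and a morphism $u$ to left multiplication by $u$. Thus for $\tilde D=\pi_{\mathcal{C}}(N)\circ t$, $u_*$ is $m\mapsto u\cdot m$ and $v^*$ is the identity of $\mathrm{id}_{t(u)}\cdot N$. **First Baues--Wirsching cohomology.** A derivation from $\mathcal{C}$ to $D$ is a map $d$ assigning to each morphism $f$ of $\mathcal{C}$ an element $d(f)\in D_f$ with $d(f\circ g)=f_*(dg)+g^*(df)$ for all composable $f,g$. It is inner if there is $(n_x)_x\in\prod_{x\in P}D_{\mathrm{id}_x}$ with $d(f)=f_*(n_{s(f)})-f^*(n_{t(f)})$ for all $f$. With $\mathrm{Der}(\mathcal{C},D)$ and $\mathrm{Ider}(\mathcal{C},D)$ the $k$-vector spaces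 of derivations and of inner derivations, $\mathrm{H}^1_{BW}(\mathcal{C},D)=\mathrm{Der}(\mathcal{C},D)/\mathrm{Ider}(\mathcal{C},D)$. **Auxiliary sets.** For $Q_1,Q_3\subseteq Q$ and $\hat P\subseteq P$, let $H(\hat P;Q,Q_1,Q_3)$ be the set of $h\in Q_3$ such that $t(h)\in\hat P$ and $hp$ is not a cycle in $Q$ for any path $p$ in $Q_1$. For $Q_1,Q_2\subseteq Q$ and $h\in H(\hat P;Q,Q_1,Q_3)$, let $G(Q_1,Q_2;h)$ be the set of $g\in Q_2$ such that there is a cycle in $Q_1\cup Q_2\cup\{h\}$ containing both $g$ and $h$. **Algorithm A.** Input: a finite quiver $Q$ with vertex set $P$. (All choices are arbitrary; an output is any result obtained for some choices.) 1. Set $\check P=\emptyset$, $\hat P=P$, $Q_1=\emptyset$, $Q_2=\emptyset$, $Q_3=Q$. 2. While $H(\hat P;Q,Q_1,Q_3)\ne\emptyset$: choose $h\in H(\hat P;Q,Q_1,Q_3)$; let $Q'=((Q_1\cup Q_2)\setminus G(Q_1,Q_2;h))\cup\{h\}$; let $\bar Q$ be a maximal acyclic subquiver of $Q$ including $Q'$; let $\check P=\{a\in P\mid \exists f\in\bar Q,\ t(f)=a\}$ and $\hat P=P\setminus\check P$; for each $a\in\check P$ choose $f_a\in\bar Q$ with $t(f_a)=a$; let $Q_1=\{f_a\mid a\in\check P\}$, $Q_2=\bar Q\setminus Q_1$, $Q_3=Q\setminus\bar Q$. 3. Let $l=|\check P|$. For $i=1,\dots,l$ successively: choose $x\in\check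 P$ such that no arrow in $Q_1$ has source $x$; let $a_i=x$; let $f_i=\alpha$ be the arrow $\alpha\in Q_1$ with $t(\alpha)=x$; replace $\check P$ by $\check P\setminus\{x\}$ and $Q_1$ by $Q_1\setminus\{\alpha\}$. 4. Let $\{b_1,\dots,b_m\}=\hat P$, $\{g_1,\dots,g_n\}=Q_2$, $\{h_1,\dots,h_r\}=Q_3$ (enumerations without repetition). Output: $((a_i)_{i=1}^{l};(b_i)_{i=1}^{m};(f_i)_{i=1}^{l};(g_i)_{i=1}^{n};(h_i)_{i=1}^{r})$. **Algorithm B.** Input: an output of Algorithm A. Put $Q_1=\{f_1,\dots,f_l\}$. (A path in $Q_1$ between two given vertices is unique if it exists.) For a vertex $c$ and an arrow $e$ define $\rho(c,e)\in kQ$ as follows: start with $0$; if there is a path $p$ from $c$ to $t(e)$ in $Q_1$, add $p$; if there is a path $p$ from $c$ to $s(e)$ in $Q_1$, subtract $ep$. Then: - for $1\le j\le l$: $v_{j,j}=\mathrm{id}_{a_j}$ and $v_{i,j}=0$ for $1\le i\le l$, $i\neq j$; $v_{l+i,j}=\rho(a_j,g_i)$ for $1\le i\le n$; $v_{l+n+i,j}=\rho(a_j,h_i)$ for $1\le i\le r$; - for $1\le j\le m$: $w_{i,j}=0$ for $1\le i\le l$; $w_{l+i,j}=\rho(b_j,g_i)$ for $1\le i\le n$; $w_{l+n+i,j}=\rho(b_j,h_i)$ for $1\le i\le r$. Output: $V=(v_{i,j})$ and $W=(w_{i,j})$. *)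

(* Defs.v *)
From HB Require Import structures.
From mathcomp Require Import all_boot all_order all_algebra.
From mathcomp Require Import boolp finmap monalg.

Set Implicit Arguments.
Unset Strict Implicit.
Unset Printing Implicit Defensive.

Import GRing.Theory.
Local Open Scope ring_scope.

Section DependentProduct.
Variables (k : pzRingType) (I : Type) (V : I -> lmodType k).

(* When [I] is finite this is the direct sum of the [V i]. *)
Definition dprod := forall i : I, V i.

HB.instance Definition _ := gen_eqMixin dprod.
HB.instance Definition _ := gen_choiceMixin dprod.

Implicit Types u v w : dprod.

Definition dprod_zero : dprod := fun=> 0.
Definition dprod_opp u : dprod := fun i => - u i.
Definition dprod_add u v : dprod := fun i => u i + v i.
Definition dprod_scale (c : k) u : dprod := fun i => c *: u i.

Fact dprod_addA : associative dprod_add.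
Proof. by move=> u v w; apply: functional_extensionality_dep => i; exact: addrA. Qed.
Fact dprod_addC : commutative dprod_add.
Proof. by move=> u v; apply: functional_extensionality_dep => i; exact: addrC. Qed.
Fact dprod_add0 : left_id dprod_zero dprod_add.
Proof. by move=> u; apply: functional_extensionality_dep => i; exact: add0r. Qed.
Fact dprod_addN : left_inverse dprod_zero dprod_opp dprod_add.
Proof. by move=> u; apply: functional_extensionality_dep => i; exact: addNr. Qed.

HB.instance Definition _ := GRing.isZmodule.Build dprod
  dprod_addA dprod_addC dprod_add0 dprod_addN.

Fact dprod_scaleA b c u : dprod_scale b (dprod_scale c u) = dprod_scale (b * c) u.
Proof. by apply: functional_extensionality_dep => i; exact: scalerA. Qed.
Fact dprod_scale1 : left_id 1 dprod_scale.
Proof. by move=> u; apply: functional_extensionality_dep => i; exact: scale1r. Qed.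
Fact dprod_scaleDr : right_distributive dprod_scale +%R.
Proof. by move=> c u v; apply: functional_extensionality_dep => i; exact: scalerDr. Qed.
Fact dprod_scaleDl u : {morph dprod_scale^~ u : b c / b + c}.
Proof. by move=> b c; apply: functional_extensionality_dep => i; exact: scalerDl. Qed.

HB.instance Definition _ := GRing.Zmodule_isLmodule.Build k dprod
  dprod_scaleA dprod_scale1 dprod_scaleDr dprod_scaleDl.

End DependentProduct.

Section Submodules.
Variables (k : pzRingType) (V : lmodType k).

Record submod (S : submodClosed V) := Submod {
  submod_val :> V;
  submod_valP : submod_val \in S }.

Definition span (X : V -> Prop) : {pred V} := fun v =>
  `[< exists (d : nat) (c : 'I_d -> k) (x : 'I_d -> V),
        (forall i, X (x i)) /\ v = \sum_(i < d) c i *: x i >].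

Fact span_closed X : submod_closed (span X).
Proof.
split.
  apply/asboolP; exists 0%N, (fun=> 0), (fun=> 0).
  by split; [case | rewrite big_ord0].
move=> a u v /asboolP[d [c [x [Xx ->]]]] /asboolP[e [b [y [Xy ->]]]].
apply/asboolP; exists (d + e)%N.
exists (fun i => match split i with inl j => a * c j | inr j => b j end).
exists (fun i => match split i with inl j => x j | inr j => y j end).
split=> [i|]; first by case: (split i).
rewrite big_split_ord /= scaler_sumr; congr (_ + _); apply: eq_bigr => i _.
  by rewrite (unsplitK (inl i)) scalerA.
by rewrite (unsplitK (inr i)).
Qed.
HB.instance Definition _ X := GRing.isSubmodClosed.Build k V (span X)
  (span_closed X).

Definition sumsub (S T : {pred V}) : {pred V} := fun v =>
  `[< exists s t, [/\ s \in S, t \in T & v = s + t] >].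

Fact sumsub_closed (S T : submodClosed V) : submod_closed (sumsub S T).
Proof.
split.
  by apply/asboolP; exists 0, 0; split; rewrite ?rpred0 ?addr0.
move=> a u v /asboolP[s [t [Ss Tt ->]]] /asboolP[s' [t' [Ss' Tt' ->]]].
apply/asboolP; exists (a *: s + s'), (a *: t + t').
by split; rewrite ?rpredD ?rpredZ // scalerDr addrACA.
Qed.
HB.instance Definition _ (S T : submodClosed V) :=
  GRing.isSubmodClosed.Build k V (sumsub S T) (sumsub_closed S T).

End Submodules.

HB.instance Definition _ k V S := [isSub for @submod_val k V S].
HB.instance Definition _ k V S := [Choice of @submod k V S by <:].
HB.instance Definition _ k V S :=
  [SubChoice_isSubLmodule of @submod k V S by <:].

Section QuotientModule.
Local Open Scope quotient_scope.
Variables (k : pzRingType) (V : lmodType k) (S : submodClosed V).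

(* Over a ring, closure under scaling by [-1] gives closure under opposite,
   which [submodClosed] does not record. *)
Definition sub_zmod : {pred V} := fun v => v \in S.
Fact sub_zmod_closed : zmod_closed sub_zmod.
Proof.
split; first exact: (rpred0 S).
move=> u v Su Sv; have : u + -1 *: v \in S by rewrite rpredD ?rpredZ.
by rewrite scaleN1r.
Qed.
HB.instance Definition _ := GRing.isZmodClosed.Build V sub_zmod sub_zmod_closed.

Definition quotmod := Quotient.quot sub_zmod.
HB.instance Definition _ := GRing.Zmodule.on quotmod.

Definition quot_pi (v : V) : quotmod := \pi_quotmod v.
Definition quot_repr (x : quotmod) : V := repr x.

Lemma quot_reprK : cancel quot_repr quot_pi.
Proof. by move=> x; exact: reprK. Qed.

Lemma quot_piP u v : reflect (quot_pi u = quot_pi v) (u - v \in S).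
Proof.
apply: (equivP idP); split=> [H | /eqP H].
  by apply/eqP; apply: (etrans (esym (Quotient.idealrBE sub_zmod _ _))).
by apply: (etrans (Quotient.idealrBE sub_zmod _ _)).
Qed.

Lemma quot_piD u v : quot_pi (u + v) = quot_pi u + quot_pi v.
Proof. exact: Quotient.pi_add. Qed.

Definition quot_scale (c : k) (x : quotmod) : quotmod :=
  quot_pi (c *: quot_repr x).

Lemma quot_piZ c v : quot_pi (c *: v) = quot_scale c (quot_pi v).
Proof.
apply/quot_piP; rewrite -scalerBr rpredZ //.
by apply/quot_piP; rewrite quot_reprK.
Qed.

Fact quot_scaleA b c x : quot_scale b (quot_scale c x) = quot_scale (b * c) x.
Proof. by rewrite -[x]quot_reprK -!quot_piZ scalerA. Qed.
Fact quot_scale1 : left_id 1 quot_scale.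
Proof. by move=> x; rewrite -[x]quot_reprK -quot_piZ scale1r. Qed.
Fact quot_scaleDr : right_distributive quot_scale +%R.
Proof.
move=> c x y; rewrite -[x]quot_reprK -[y]quot_reprK.
by rewrite -!quot_piZ -!quot_piD -quot_piZ scalerDr.
Qed.
Fact quot_scaleDl x : {morph quot_scale^~ x : b c / b + c}.
Proof.
by move=> b c; rewrite -[x]quot_reprK -!quot_piZ -quot_piD scalerDl.
Qed.

HB.instance Definition _ := GRing.Zmodule_isLmodule.Build k quotmod
  quot_scaleA quot_scale1 quot_scaleDr quot_scaleDl.

Fact quot_pi_linear : linear quot_pi.
Proof. by move=> c u v; rewrite quot_piD quot_piZ. Qed.
HB.instance Definition _ := GRing.isLinear.Build k V quotmod *:%R quot_pi
  quot_pi_linear.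

End QuotientModule.

Record category := Category {
  ob :> Type;
  hom : ob -> ob -> Type;
  idm : forall x, hom x x;
  comp : forall x y z, hom y z -> hom x y -> hom x z;
  comp1m : forall x y (f : hom x y), comp (idm y) f = f;
  compm1 : forall x y (f : hom x y), comp f (idm x) = f;
  compA : forall w x y z (f : hom y z) (g : hom x y) (h : hom w x),
    comp f (comp g h) = comp (comp f g) h }.

Arguments hom {c}.
Arguments idm {c}.
Arguments comp {c x y z}.

Record functor (C D : category) := Functor {
  fob :> C -> D;
  fhom : forall x y, hom x y -> hom (fob x) (fob y);
  fhom1 : forall x, fhom (idm x) = idm (fob x);
  fhomM : forall x y z (f : hom y z) (g : hom x y),
    fhom (comp f g) = comp (fhom f) (fhom g) }.

(* Functors from [C] to [k]-Mod. *)
Record modfunctor (k : pzRingType) (C : category) := ModFunctor {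
  mob :> C -> lmodType k;
  mhom : forall x y : C, hom x y -> {linear mob x -> mob y};
  mhom1 : forall x, mhom (idm x) =1 id;
  mhomM : forall x y z (f : hom y z) (g : hom x y),
    mhom (comp f g) =1 mhom f \o mhom g }.

Definition comp_modfunctor k (C D : category) (M : modfunctor k D)
  (F : functor C D) : modfunctor k C.
Proof.
refine (@ModFunctor k C (fun x => M (F x)) (fun x y f => mhom M (fhom F f)) _ _).
- by move=> x v; rewrite fhom1 mhom1.
- by move=> x y z f g v; rewrite fhomM mhomM.
Defined.

Section Factorizations.
Variable C : category.

Record mor := Mor { dom : C; cod : C; arr : hom dom cod }.

Definition fact_hom (a b : mor) :=
  {uv : hom (cod a) (cod b) * hom (dom b) (dom a)
      | arr b = comp uv.1 (comp (arr a) uv.2)}.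

Fact fact_hom_eq a b (p q : fact_hom a b) : proj1_sig p = proj1_sig q -> p = q.
Proof. by case: p q => [p Hp] [q Hq] /= E; exact: eq_exist. Qed.

Fact fact_idP (a : mor) : arr a = comp (idm _) (comp (arr a) (idm _)).
Proof. by rewrite comp1m compm1. Qed.

Definition fact_id a : fact_hom a a := exist _ (idm _, idm _) (fact_idP a).

Fact fact_compP a b c (p : fact_hom b c) (q : fact_hom a b) :
  arr c = comp (comp (proj1_sig p).1 (proj1_sig q).1)
            (comp (arr a) (comp (proj1_sig q).2 (proj1_sig p).2)).
Proof.
by case: p q => [[u' v'] /= ->] [[u v] /= ->]; rewrite !compA.
Qed.

Definition fact_comp a b c (p : fact_hom b c) (q : fact_hom a b) :
    fact_hom a c :=
  exist _ (comp (proj1_sig p).1 (proj1_sig q).1,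
           comp (proj1_sig q).2 (proj1_sig p).2) (fact_compP p q).

Definition factcat : category.
Proof.
refine (@Category mor fact_hom fact_id fact_comp _ _ _).
- by move=> a b [[u v] H]; apply: fact_hom_eq; rewrite /= comp1m compm1.
- by move=> a b [[u v] H]; apply: fact_hom_eq; rewrite /= comp1m compm1.
- by move=> a b c d p q s; apply: fact_hom_eq; rewrite /= !compA.
Defined.

Definition target : functor factcat C.
Proof.
by refine (@Functor factcat C cod (fun a b p => (proj1_sig p).1) _ _).
Defined.

End Factorizations.

Arguments Mor {C dom cod}.

Notation natural_system k C := (modfunctor k (factcat C)).

Section BauesWirsching.
Variables (k : pzRingType) (C : category) (D : natural_system k C).

Section Actions.
Variables (x y z : C) (u : hom y z) (v : hom x y) (w : hom x z).
Hypothesis E : w = comp u v.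

Fact pushP : w = comp u (comp v (idm x)). Proof. by rewrite compm1. Qed.
Fact pullP : w = comp (idm z) (comp u v). Proof. by rewrite comp1m. Qed.

(* [u_*] and [v^*]; the codomain is indexed by any [w] equal to the composite
   [u v], so that no transport is needed when [u] or [v] is an identity. *)
Definition push : {linear D (Mor v) -> D (Mor w)} :=
  @mhom k _ D (Mor v) (Mor w) (exist _ (u, idm x) pushP).
Definition pull : {linear D (Mor u) -> D (Mor w)} :=
  @mhom k _ D (Mor u) (Mor w) (exist _ (idm z, v) pullP).

End Actions.

Definition cochain1 := dprod (fun f : mor C => D f).

Definition derivation (d : cochain1) :=
  forall (x y z : C) (f : hom y z) (g : hom x y),
    d (Mor (comp f g)) =
      push (erefl (comp f g)) (d (Mor g)) + pull (erefl (comp f g)) (d (Mor f)).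

Definition inner (d : cochain1) :=
  exists e : forall x : C, D (Mor (idm x)),
    forall (x y : C) (f : hom x y),
      d (Mor f) = push (esym (compm1 f)) (e x) - pull (esym (comp1m f)) (e y).

Definition is_der : {pred cochain1} := fun d => `[< derivation d >].

Fact is_der_closed : submod_closed is_der.
Proof.
split.
  by apply/asboolP => x y z f g; rewrite !linear0 addr0.
move=> a d d' /asboolP Hd /asboolP Hd'; apply/asboolP => x y z f g.
have E h : (a *: d + d' : cochain1) h = a *: d h + d' h by [].
by rewrite !E Hd Hd' !linearP /= scalerDr addrACA.
Qed.
HB.instance Definition _ := GRing.isSubmodClosed.Build k cochain1 is_der
  is_der_closed.

Definition Der := submod is_der.
HB.instance Definition _ := GRing.Lmodule.on Der.

Definition Ider : {pred Der} := fun d => `[< inner (val d) >].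

Fact Ider_closed : submod_closed Ider.
Proof.
split.
  by apply/asboolP; exists (fun=> 0) => x y f; rewrite !linear0 addr0.
move=> a d d' /asboolP[e He] /asboolP[e' He']; apply/asboolP.
exists (fun x => a *: e x + e' x) => x y f.
have E h : val (a *: d + d') h = a *: val d h + val d' h by [].
by rewrite E He He' !linearP /= scalerDr addrACA.
Qed.
HB.instance Definition _ := GRing.isSubmodClosed.Build k Der Ider Ider_closed.

Definition H1_BW : lmodType k := quotmod Ider.

End BauesWirsching.

Record quiver := Quiver {
  vertex : finType;
  arrow : finType;
  src : arrow -> vertex;
  tgt : arrow -> vertex }.

Arguments src {q}.
Arguments tgt {q}.

Section Paths.
Variable Q : quiver.
Implicit Types (x y z : vertex Q) (p q c : seq (arrow Q)).

(* [f_1 ... f_l] goes from [src f_l] to [tgt f_1]. *)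
Fixpoint is_path x y p : bool :=
  if p is f :: p' then (tgt f == y) && is_path x (src f) p' else x == y.

Definition is_cycle c := (c != [::]) && [exists x, is_path x x c].

Definition acyclic (A : {set arrow Q}) :=
  forall c, all (mem A) c -> ~~ is_cycle c.

Definition path_hom x y := {p : seq (arrow Q) | is_path x y p}.

Lemma is_path_cat x y z p q : is_path y z p -> is_path x y q -> is_path x z (p ++ q).
Proof.
elim: p z => [|f p IH] z /=; first by move/eqP=> <-.
by case/andP=> -> /IH H /H.
Qed.

Definition path_id x : path_hom x x := exist _ [::] (eqxx x).

Definition path_comp x y z (p : path_hom y z) (q : path_hom x y) : path_hom x z :=
  exist _ (val p ++ val q) (is_path_cat (valP p) (valP q)).

Definition freecat : category.
Proof.
refine (@Category (vertex Q) path_hom path_id path_comp _ _ _).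
- by move=> x y f; apply: val_inj.
- by move=> x y f; apply: val_inj; rewrite /= cats0.
- by move=> w x y z f g h; apply: val_inj; rewrite /= catA.
Defined.

Fact arrow_path (e : arrow Q) : is_path (src e) (tgt e) [:: e].
Proof. by rewrite /= !eqxx. Qed.

Definition arrow_hom (e : arrow Q) : @hom freecat (src e) (tgt e) :=
  exist _ [:: e] (arrow_path e).

End Paths.

Arguments arrow_hom {Q}.

HB.instance Definition _ (Q : quiver) := gen_eqMixin (mor (freecat Q)).
HB.instance Definition _ (Q : quiver) := gen_choiceMixin (mor (freecat Q)).

Section CategoryAlgebra.
Variables (k : fieldType) (Q : quiver).
Local Notation M := (mor (freecat Q)).
Implicit Types (a b c : M).

Definition catalg := {malg k[M]}.
HB.instance Definition _ := GRing.Lmodule.on catalg.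
Implicit Types (s t : catalg).

Definition mor_comp a b : option M :=
  match @eqP (vertex Q) (cod b) (dom a) with
  | ReflectT e =>
      Some (Mor (comp (arr a) (ecast y (@hom (freecat Q) (dom b) y) e (arr b))))
  | ReflectF _ => None
  end.

Definition basis a : catalg := << a >>.

Definition basis_mul a b : catalg :=
  if mor_comp a b is Some c then basis c else 0.

Definition catalg_one : catalg :=
  \sum_(x : vertex Q) basis (Mor (idm (x : freecat Q))).

Definition catalg_mul s t : catalg :=
  \sum_(a <- msupp s) \sum_(b <- msupp t) (s@_a * t@_b) *: basis_mul a b.

Lemma mor_comp_def (x y z : freecat Q) (f : hom y z) (g : hom x y) :
  mor_comp (Mor f) (Mor g) = Some (Mor (comp f g)).
Proof.
rewrite /mor_comp /=; case: eqP => [e|//].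
by rewrite (eq_irrelevance e (erefl y)).
Qed.

Lemma mor_comp_ndef a b : cod b != dom a -> mor_comp a b = None.
Proof. by rewrite /mor_comp; case: eqP. Qed.

Lemma mor_compA a b c :
  obind (mor_comp a) (mor_comp b c) = obind (mor_comp^~ c) (mor_comp a b).
Proof.
case: a => a1 a2 f; case: b => b1 b2 g; case: c => c1 c2 h.
have [e1|n1] := eqVneq c2 b1; last first.
  rewrite (@mor_comp_ndef (Mor g)) //=.
  have [e2|n2] := eqVneq b2 a1; last by rewrite mor_comp_ndef.
  by subst b2; rewrite mor_comp_def /= mor_comp_ndef.
subst c2; rewrite mor_comp_def /=.
have [e2|n2] := eqVneq b2 a1; last by rewrite !mor_comp_ndef.
subst b2; rewrite !mor_comp_def /= mor_comp_def; congr (Some (Mor _)).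
exact: (@compA (freecat Q)).
Qed.

Lemma catalg_mulw (d1 d2 : {fset M}) s t :
  (msupp s `<=` d1)%fset -> (msupp t `<=` d2)%fset ->
  catalg_mul s t = \sum_(a <- d1) \sum_(b <- d2) (s@_a * t@_b) *: basis_mul a b.
Proof.
move=> le1 le2; rewrite /catalg_mul (big_fset_incl _ le1) /=.
  apply: eq_bigr => a _; apply: big_fset_incl => // b _ /mcoeff_outdom ->.
  by rewrite mulr0 scale0r.
move=> a _ /mcoeff_outdom ->.
by rewrite big1 // => b _; rewrite mul0r scale0r.
Qed.

Fact catalg_mulDl : left_distributive catalg_mul +%R.
Proof.
move=> s s' t.
rewrite [in RHS](catalg_mulw (fsubsetUl _ (msupp s')) (fsubset_refl _)).
rewrite [in RHS](catalg_mulw (fsubsetUr (msupp s) _) (fsubset_refl _)).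
rewrite (catalg_mulw (msuppD_le _ _) (fsubset_refl _)) -big_split.
apply: eq_bigr => a _; rewrite -big_split; apply: eq_bigr => b _.
by rewrite mcoeffD mulrDl scalerDl.
Qed.

Fact catalg_mulDr : right_distributive catalg_mul +%R.
Proof.
move=> s t t'.
rewrite [in RHS](catalg_mulw (fsubset_refl _) (fsubsetUl _ (msupp t'))).
rewrite [in RHS](catalg_mulw (fsubset_refl _) (fsubsetUr (msupp t) _)).
rewrite (catalg_mulw (fsubset_refl _) (msuppD_le _ _)) -big_split.
apply: eq_bigr => a _; rewrite -big_split; apply: eq_bigr => b _.
by rewrite mcoeffD mulrDr scalerDl.
Qed.

Fact catalg_mulZl (c : k) s t : catalg_mul (c *: s) t = c *: catalg_mul s t.
Proof.
rewrite (catalg_mulw (msuppZ_le _ _) (fsubset_refl _)) scaler_sumr.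
apply: eq_bigr => a _; rewrite scaler_sumr; apply: eq_bigr => b _.
by rewrite mcoeffZ scalerA mulrA.
Qed.

Fact catalg_mulZr (c : k) s t : catalg_mul s (c *: t) = c *: catalg_mul s t.
Proof.
rewrite (catalg_mulw (fsubset_refl _) (msuppZ_le _ _)) scaler_sumr.
apply: eq_bigr => a _; rewrite scaler_sumr; apply: eq_bigr => b _.
by rewrite mcoeffZ scalerA mulrCA.
Qed.

Fact catalg_mul0l t : catalg_mul 0 t = 0.
Proof. by rewrite -[X in catalg_mul X _](scale0r 0) catalg_mulZl scale0r. Qed.

Fact catalg_mul0r s : catalg_mul s 0 = 0.
Proof. by rewrite -[X in catalg_mul _ X](scale0r 0) catalg_mulZr scale0r. Qed.

Lemma catalg_mul_suml I (r : seq I) (F : I -> catalg) t :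
  catalg_mul (\sum_(i <- r) F i) t = \sum_(i <- r) catalg_mul (F i) t.
Proof.
exact: (big_morph (catalg_mul^~ t) (fun s s' => catalg_mulDl s s' t)
  (catalg_mul0l t)).
Qed.

Lemma catalg_mul_sumr I (r : seq I) (F : I -> catalg) s :
  catalg_mul s (\sum_(i <- r) F i) = \sum_(i <- r) catalg_mul s (F i).
Proof.
exact: (big_morph (catalg_mul s) (fun t t' => catalg_mulDr s t t')
  (catalg_mul0r s)).
Qed.

Lemma catalgE s : s = \sum_(a <- msupp s) s@_a *: basis a.
Proof.
rewrite [LHS]monalgE; apply: eq_bigr => a _.
by apply/malgP => b; rewrite mcoeffZ !mcoeffU mulr_natr.
Qed.

Lemma catalg_mulUU a b : catalg_mul (basis a) (basis b) = basis_mul a b.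
Proof.
rewrite (catalg_mulw (msuppU_le (k := a)) (msuppU_le (k := b))) !big_seq_fset1.
by rewrite !mcoeffUU mulr1 scale1r.
Qed.

Lemma catalg_ind (P : catalg -> Prop) : P 0 ->
  (forall s t, P s -> P t -> P (s + t)) -> (forall (c : k) s, P s -> P (c *: s)) ->
  (forall a, P (basis a)) -> forall s, P s.
Proof.
move=> P0 PD PZ PU s; rewrite [s]catalgE.
by elim/big_ind: _ => // a _; exact: PZ.
Qed.

Lemma basis_mulA a b c :
  catalg_mul (basis a) (basis_mul b c) = catalg_mul (basis_mul a b) (basis c).
Proof.
have -> : catalg_mul (basis a) (basis_mul b c)
    = oapp basis 0 (obind (mor_comp a) (mor_comp b c)).
  rewrite /basis_mul; case: (mor_comp b c) => [d|] /=; last exact: catalg_mul0r.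
  by rewrite catalg_mulUU /basis_mul; case: mor_comp.
rewrite mor_compA /basis_mul; case: (mor_comp a b) => [d|] /=.
  by rewrite catalg_mulUU /basis_mul; case: mor_comp.
by rewrite catalg_mul0l.
Qed.

Fact catalg_mulA : associative catalg_mul.
Proof.
move=> s t u; elim/catalg_ind: s => [|s s' IH IH'|c s IH|a].
- by rewrite !catalg_mul0l.
- by rewrite !catalg_mulDl IH IH'.
- by rewrite !catalg_mulZl IH.
elim/catalg_ind: t => [|s s' IH IH'|c s IH|b].
- by rewrite !(catalg_mul0l, catalg_mul0r).
- by rewrite !(catalg_mulDl, catalg_mulDr) IH IH'.
- by rewrite !(catalg_mulZl, catalg_mulZr) IH.
elim/catalg_ind: u => [|s s' IH IH'|d s IH|c].
- by rewrite !catalg_mul0r.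
- by rewrite !catalg_mulDr IH IH'.
- by rewrite !catalg_mulZr IH.
by rewrite !catalg_mulUU basis_mulA.
Qed.

Fact catalg_mul1 : left_id catalg_one catalg_mul.
Proof.
elim/catalg_ind => [|s s' IH IH'|c s IH|[x y f]].
- exact: catalg_mul0r.
- by rewrite catalg_mulDr IH IH'.
- by rewrite catalg_mulZr IH.
rewrite catalg_mul_suml (bigD1 (y : vertex Q)) //= big1 => [|z zy].
  by rewrite addr0 catalg_mulUU /basis_mul mor_comp_def comp1m.
by rewrite catalg_mulUU /basis_mul mor_comp_ndef //= eq_sym.
Qed.

Fact catalg_mulr1 : right_id catalg_one catalg_mul.
Proof.
elim/catalg_ind => [|s s' IH IH'|c s IH|[x y f]].
- exact: catalg_mul0l.
- by rewrite catalg_mulDl IH IH'.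
- by rewrite catalg_mulZl IH.
rewrite catalg_mul_sumr (bigD1 (x : vertex Q)) //= big1 => [|z zy].
  by rewrite addr0 catalg_mulUU /basis_mul mor_comp_def compm1.
by rewrite catalg_mulUU /basis_mul mor_comp_ndef.
Qed.

(* Not a [nzRingType], hence not an [algType]: [Q] may have no vertex. *)
HB.instance Definition _ := GRing.Zmodule_isPzRing.Build catalg
  catalg_mulA catalg_mul1 catalg_mulr1 catalg_mulDl catalg_mulDr.

Lemma catalg_scaleAl (c : k) s t : c *: (s * t) = (c *: s) * t.
Proof. exact: esym (catalg_mulZl c s t). Qed.

Lemma catalg_scaleAr (c : k) s t : c *: (s * t) = s * (c *: t).
Proof. exact: esym (catalg_mulZr c s t). Qed.

Definition path_elt (x y : freecat Q) (u : hom x y) : catalg := basis (Mor u).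

Lemma path_eltM (x y z : freecat Q) (u : hom y z) (v : hom x y) :
  path_elt u * path_elt v = path_elt (comp u v).
Proof.
by apply: etrans (catalg_mulUU _ _) _; rewrite /basis_mul mor_comp_def.
Qed.

Lemma path_eltM0 (w x y z : freecat Q) (u : hom y z) (v : hom w x) :
  x != y :> vertex Q -> path_elt u * path_elt v = 0.
Proof.
by move=> xy; apply: etrans (catalg_mulUU _ _) _; rewrite /basis_mul mor_comp_ndef.
Qed.

End CategoryAlgebra.

Arguments path_elt {k Q x y}.

Section ModuleSystem.
Variables (k : fieldType) (Q : quiver) (N : lmodType (catalg k Q)).

(* [N] as a [k]-vector space, by restriction of scalars. *)
Definition kspace : Type := N.
HB.instance Definition _ := GRing.Zmodule.on kspace.

Definition kspace_scale (c : k) (m : kspace) : kspace :=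
  ((c *: (1 : catalg k Q)) : catalg k Q) *: (m : N).

Fact kspace_scaleA b c m :
  kspace_scale b (kspace_scale c m) = kspace_scale (b * c) m.
Proof. by rewrite /kspace_scale scalerA -catalg_scaleAl mul1r scalerA. Qed.
Fact kspace_scale1 : left_id 1 kspace_scale.
Proof. by move=> m; rewrite /kspace_scale !scale1r. Qed.
Fact kspace_scaleDr : right_distributive kspace_scale +%R.
Proof. by move=> c m m'; exact: scalerDr. Qed.
Fact kspace_scaleDl m : {morph kspace_scale^~ m : b c / b + c}.
Proof. by move=> b c; rewrite /kspace_scale !scalerDl. Qed.

HB.instance Definition _ := GRing.Zmodule_isLmodule.Build k kspace
  kspace_scaleA kspace_scale1 kspace_scaleDr kspace_scaleDl.

Definition alg_act (s : catalg k Q) (m : kspace) : kspace := s *: (m : N).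

Fact alg_act_linear s : linear (alg_act s).
Proof.
move=> c m m'; rewrite /alg_act [LHS]scalerDr; congr (_ + _).
apply: etrans (scalerA _ _ (m : N)) _; apply: etrans (esym (scalerA _ _ (m : N))).
by congr (_ *: _); rewrite -catalg_scaleAr -catalg_scaleAl mulr1 mul1r.
Qed.
HB.instance Definition _ s := GRing.isLinear.Build k kspace kspace *:%R
  (alg_act s) (alg_act_linear s).

Lemma alg_actM s t m : alg_act (s * t) m = alg_act s (alg_act t m).
Proof. exact: esym (scalerA s t (m : N)). Qed.

(* The subspace [id_x . N]. *)
Definition at_vertex (x : freecat Q) : {pred kspace} := fun m =>
  `[< exists m' : kspace, m = alg_act (path_elt (idm x)) m' >].

Fact at_vertex_closed x : submod_closed (at_vertex x).
Proof.
split; first by apply/asboolP; exists 0; rewrite linear0.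
move=> c m m' /asboolP[n ->] /asboolP[n' ->]; apply/asboolP.
by exists (c *: n + n'); rewrite linearP.
Qed.
HB.instance Definition _ x := GRing.isSubmodClosed.Build k kspace (at_vertex x)
  (at_vertex_closed x).

Definition piC_ob (x : freecat Q) : lmodType k := submod (at_vertex x).

Fact piC_homP (x y : freecat Q) (u : hom x y) (m : piC_ob x) :
  alg_act (path_elt u) (val m) \in at_vertex y.
Proof.
apply/asboolP; exists (alg_act (path_elt u) (val m)).
by rewrite -alg_actM path_eltM comp1m.
Qed.

Definition piC_act (x y : freecat Q) (u : hom x y) (m : piC_ob x) : piC_ob y :=
  Submod (piC_homP u m).

Fact piC_act_linear x y (u : @hom (freecat Q) x y) : linear (piC_act u).
Proof. by move=> c m m'; apply: val_inj; rewrite /= linearP. Qed.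
HB.instance Definition _ x y (u : @hom (freecat Q) x y) :=
  GRing.isLinear.Build k (piC_ob x) (piC_ob y) *:%R (piC_act u)
    (piC_act_linear u).

Definition piC : modfunctor k (freecat Q).
Proof.
refine (@ModFunctor k (freecat Q) piC_ob (fun x y u => piC_act u) _ _).
- move=> x m; apply: val_inj => /=.
  have /asboolP[m' ->] := submod_valP m.
  by rewrite -alg_actM path_eltM comp1m.
- move=> x y z f g m; apply: val_inj => /=.
  by rewrite -alg_actM path_eltM.
Defined.

Definition Dtilde : natural_system k (freecat Q) :=
  comp_modfunctor piC (target (freecat Q)).

End ModuleSystem.

Section AlgorithmA.
Variable Q : quiver.
Implicit Types (P : {set vertex Q}).

Definition Hset P (Q1 Q3 : {set arrow Q}) : {set arrow Q} :=
  [set h in Q3 | (tgt h \in P) &&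
     `[< forall x p, is_path x (src h) p -> all (mem Q1) p ->
           ~~ is_cycle (h :: p) >]].

Definition Gset (Q1 Q2 : {set arrow Q}) (h : arrow Q) : {set arrow Q} :=
  [set g in Q2 | `[< exists c, [/\ is_cycle c,
     all (mem (Q1 :|: Q2 :|: [set h])) c, g \in c & h \in c] >]].

(* [loopA Pc Ph Q1 Q2 Q3]: the values of the five variables may occur at the
   entry of the loop body or at its exit. *)
Inductive loopA : {set vertex Q} -> {set vertex Q} ->
    {set arrow Q} -> {set arrow Q} -> {set arrow Q} -> Prop :=
| loopA_init : loopA set0 setT set0 set0 setT
| loopA_step Pc Ph Q1 Q2 Q3 (h : arrow Q) (Qb : {set arrow Q})
    (f : vertex Q -> arrow Q) :
    loopA Pc Ph Q1 Q2 Q3 ->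
    h \in Hset Ph Q1 Q3 ->
    (Q1 :|: Q2) :\: Gset Q1 Q2 h :|: [set h] \subset Qb ->
    maxset (fun A => `[< acyclic A >]) Qb ->
    let Pc' := [set a | [exists e in Qb, tgt e == a]] in
    {in Pc', forall a, f a \in Qb /\ tgt (f a) = a} ->
    let Q1' := [set f a | a in Pc'] in
    loopA Pc' (~: Pc') Q1' (Qb :\: Q1') (~: Qb).

Inductive peelA : {set vertex Q} -> {set arrow Q} ->
    seq (vertex Q) -> seq (arrow Q) -> Prop :=
| peelA_nil Q1 : peelA set0 Q1 [::] [::]
| peelA_cons (Pc : {set vertex Q}) (Q1 : {set arrow Q}) x e a f :
    x \in Pc -> [forall e' in Q1, src e' != x] ->
    e \in Q1 -> tgt e = x ->
    peelA (Pc :\ x) (Q1 :\ e) a f ->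
    peelA Pc Q1 (x :: a) (e :: f).

Definition enumerates (T : finType) (A : {set T}) (s : seq T) :=
  uniq s /\ s =i A.

Definition outputA l m n r (a : l.-tuple (vertex Q)) (b : m.-tuple (vertex Q))
    (f : l.-tuple (arrow Q)) (g : n.-tuple (arrow Q))
    (h : r.-tuple (arrow Q)) : Prop :=
  exists Pc Ph Q1 Q2 Q3,
    [/\ loopA Pc Ph Q1 Q2 Q3 /\ Hset Ph Q1 Q3 = set0,
        peelA Pc Q1 a f,
        enumerates Ph b, enumerates Q2 g & enumerates Q3 h].

End AlgorithmA.

Section AlgorithmB.
Variables (k : fieldType) (Q : quiver).
Local Notation kC := (catalg k Q).

Section Rho.
Variable Q1 : {set arrow Q}.

(* The choice is irrelevant where this is used: paths in the [Q1] of an output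
   of Algorithm A are determined by their endpoints. *)
Definition path_in (x y : freecat Q) : option (hom x y) :=
  if pselect (exists p : path_hom x y, all (mem Q1) (val p)) is left H
  then Some (projT1 (cid H)) else None.

Definition rho (c : freecat Q) (e : arrow Q) : kC :=
  oapp path_elt 0 (path_in c (tgt e))
  - oapp (fun p => path_elt (comp (arrow_hom e) p)) 0 (path_in c (src e)).

End Rho.

Variables (l m n r : nat) (a : l.-tuple (vertex Q)) (b : m.-tuple (vertex Q))
  (f : l.-tuple (arrow Q)) (g : n.-tuple (arrow Q)) (h : r.-tuple (arrow Q)).

Local Notation Q1 := [set e in f].

Definition matV : 'M[kC]_(l + n + r, l) :=
  col_mx
    (col_mx
      (\matrix_(i < l, j < l)
         if i == j then path_elt (idm (tnth a j : freecat Q)) else 0)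
      (\matrix_(i < n, j < l) rho Q1 (tnth a j) (tnth g i)))
    (\matrix_(i < r, j < l) rho Q1 (tnth a j) (tnth h i)).

Definition matW : 'M[kC]_(l + n + r, m) :=
  col_mx
    (col_mx
      (0 : 'M_(l, m))
      (\matrix_(i < n, j < m) rho Q1 (tnth b j) (tnth g i)))
    (\matrix_(i < r, j < m) rho Q1 (tnth b j) (tnth h i)).

End AlgorithmB.

Section RightHandSide.
Variables (k : fieldType) (Q : quiver) (N : lmodType (catalg k Q)).
Local Notation kC := (catalg k Q).

Definition arrow_mor (e : arrow Q) : mor (freecat Q) := Mor (arrow_hom e).

Definition sum_along d (e : d.-tuple (arrow Q)) : lmodType k :=
  dprod (fun i : 'I_d => Dtilde N (arrow_mor (tnth e i))).

Variables (l n r : nat)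
  (f : l.-tuple (arrow Q)) (g : n.-tuple (arrow Q)) (h : r.-tuple (arrow Q)).

Definition A123 : lmodType k :=
  (sum_along f * sum_along g * sum_along h)%type.

Definition coord (x : A123) (i : 'I_(l + n + r)) : N :=
  match split i with
  | inl i' => match split i' with
              | inl i1 => submod_val (x.1.1 i1)
              | inr i2 => submod_val (x.1.2 i2)
              end
  | inr i3 => submod_val (x.2 i3)
  end.

(* [x] is [M_j nu], for [M_j] the [j]-th column of [M]; [col_times_matV] and
   [col_times_matW] show that this product lies in [A123] when [M] is the output
   [matV] or [matW] of Algorithm B. *)
Definition is_col_times d (M : 'M[kC]_(l + n + r, d)) (j : 'I_d)
    (nu : kspace N) (x : A123) : Prop :=
  forall i, coord x i = M i j *: (nu : N).

Definition col_span d (c : d.-tuple (vertex Q)) (M : 'M[kC]_(l + n + r, d)) :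
    {pred A123} :=
  span (fun x => exists j (nu : kspace N),
          nu \in at_vertex (tnth c j) /\ is_col_times M j nu x).
HB.instance Definition _ d (c : d.-tuple (vertex Q)) M :=
  GRing.SubmodClosed.on (col_span c M).

Definition row_arrow (i : 'I_(l + n + r)) : arrow Q :=
  match split i with
  | inl i' => match split i' with
              | inl i1 => tnth f i1
              | inr i2 => tnth g i2
              end
  | inr i3 => tnth h i3
  end.

Lemma col_times_ex d (M : 'M[kC]_(l + n + r, d)) (j : 'I_d) (nu : kspace N) :
  (forall i, path_elt (idm (tgt (row_arrow i) : freecat Q)) * M i j = M i j) ->
  exists x, is_col_times M j nu x.
Proof.
move=> HM.
have HN i : alg_act (M i j) nu \in
    at_vertex (N := N) (tgt (row_arrow i) : freecat Q).
  by apply/asboolP; exists (alg_act (M i j) nu); rewrite -alg_actM HM.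
have H1 (i : 'I_l) : alg_act (M (lshift r (lshift n i)) j) nu \in
    at_vertex (N := N) (tgt (tnth f i) : freecat Q).
  move: (HN (lshift r (lshift n i))).
  by rewrite /row_arrow (unsplitK (inl (lshift n i))) (unsplitK (inl i)).
have H2 (i : 'I_n) : alg_act (M (lshift r (rshift l i)) j) nu \in
    at_vertex (N := N) (tgt (tnth g i) : freecat Q).
  move: (HN (lshift r (rshift l i))).
  by rewrite /row_arrow (unsplitK (inl (rshift l i))) (unsplitK (inr i)).
have H3 (i : 'I_r) : alg_act (M (rshift (l + n) i) j) nu \in
    at_vertex (N := N) (tgt (tnth h i) : freecat Q).
  by move: (HN (rshift (l + n) i)); rewrite /row_arrow (unsplitK (inr i)).
exists ((fun i => Submod (H1 i), fun i => Submod (H2 i)), fun i => Submod (H3 i)).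
move=> i; rewrite /coord.
case: (split_ordP i) => [i' ->|i3 ->] //=.
by case: (split_ordP i') => [i1 ->|i2 ->].
Qed.

Lemma rho_tgt (Q1 : {set arrow Q}) (c : freecat Q) (e : arrow Q) :
  path_elt (idm (tgt e : freecat Q)) * rho k Q1 c e = rho k Q1 c e.
Proof.
rewrite /rho mulrBr; congr (_ - _).
  by case: path_in => [p|] /=; rewrite ?mulr0 // path_eltM comp1m.
by case: path_in => [p|] /=; rewrite ?mulr0 // path_eltM comp1m.
Qed.

Lemma col_times_matV (a : l.-tuple (vertex Q)) j (nu : kspace N) :
  (forall i, tgt (tnth f i) = tnth a i) ->
  exists x, is_col_times (matV k a f g h) j nu x.
Proof.
move=> Ha; apply: col_times_ex => i; rewrite /row_arrow.
case: (split_ordP i) => [i' ->|i3 ->]; last by rewrite col_mxEd !mxE rho_tgt.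
rewrite col_mxEu; case: (split_ordP i') => [i1 ->|i2 ->]; last first.
  by rewrite col_mxEd !mxE rho_tgt.
rewrite col_mxEu mxE; case: eqP => [->|_]; last by rewrite mulr0.
by rewrite Ha path_eltM comp1m.
Qed.

Lemma col_times_matW m (b : m.-tuple (vertex Q)) j (nu : kspace N) :
  exists x, is_col_times (matW k b f g h) j nu x.
Proof.
apply: col_times_ex => i; rewrite /row_arrow.
case: (split_ordP i) => [i' ->|i3 ->]; last by rewrite col_mxEd !mxE rho_tgt.
rewrite col_mxEu; case: (split_ordP i') => [i1 ->|i2 ->].
  by rewrite col_mxEu mxE mulr0.
by rewrite col_mxEd !mxE rho_tgt.
Qed.

End RightHandSide.

Arguments col_span {k Q} N {l n r} f g h {d} c M.

Lemma peelA_tgt Q (Pc : {set vertex Q}) Q1 a f :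
  peelA Pc Q1 a f -> map tgt f = a.
Proof. by elim=> {Pc Q1 a f} // Pc Q1 x e a f _ _ _ /= -> _ ->. Qed.

Lemma outputA_tgt Q l m n r (a : l.-tuple (vertex Q)) (b : m.-tuple (vertex Q))
    (f : l.-tuple (arrow Q)) (g : n.-tuple (arrow Q)) (h : r.-tuple (arrow Q)) :
  outputA a b f g h -> forall i, tgt (tnth f i) = tnth a i.
Proof.
case=> Pc [Ph [Q1 [Q2 [Q3 [_ /peelA_tgt E _ _ _]]]]] i.
have <- : map_tuple tgt f = a by exact: val_inj.
by rewrite tnth_map.
Qed.

(* Main.v *)
(* A derivation on a free category is determined by arbitrary values on the
   arrows, so [H^1] is the product of the [id_t(e) N] over all arrows [e] modulo
   the coboundaries [(e n_s(e) - n_t(e))_e].  The arrows [Q1] form a forest, with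
   at most one arrow into each vertex.  Let [R(c, y)] be the path of [Q1] from
   [c] to [y], or [0]; then [rho(c, e) = R(c, t(e)) - e R(c, s(e))], which is the
   identity if [e] is in [Q1] and ends at [c] and [0] for the other [e] in [Q1].
   Hence the columns of [V] and [W] are the families [rho(c, e)], one column for
   each vertex [c], and [-(column c) x] is the coboundary of [y |-> R(c, y) x].
   As [R] is unitriangular along the forest, every [(n_y)_y] is a sum of such
   families, so these columns span exactly the coboundaries. *)
Require Import Defs.
From HB Require Import structures.
From mathcomp Require Import all_boot all_order all_algebra.
From mathcomp Require Import boolp.

Set Implicit Arguments.
Unset Strict Implicit.
Unset Printing Implicit Defensive.

Import Defs GRing.Theory.
Local Open Scope ring_scope.

(** * Spans and isomorphisms of quotients *)

Section LinearAlgebra.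
Variables (k : pzRingType).

Lemma mem_span (V : lmodType k) (X : V -> Prop) v : X v -> v \in span X.
Proof.
move=> Xv; apply/asboolP; exists 1%N, (fun=> 1), (fun=> v).
by split=> //; rewrite big_ord1 scale1r.
Qed.

Lemma span_ind (V : lmodType k) (X P : V -> Prop) :
  P 0 -> (forall c u v, P u -> P v -> P (c *: u + v)) ->
  (forall v, X v -> P v) -> forall v, v \in span X -> P v.
Proof.
move=> P0 PD PX v /asboolP[d [c [x [Xx ->]]]].
elim/big_rec: _ => // i u _; exact/PD/PX/Xx.
Qed.

(** The induced map is well defined and injective because [S] is the full preimage of [T], and onto
    because [F] is. The inverse only has to be a function, so a set-theoretic section [G] of [F]
    suffices. *)
Lemma quotmod_iso (U V : lmodType k) (S : submodClosed U) (T : submodClosed V)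
    (F : U -> V) :
  linear F -> (forall v, exists u, F u = v) ->
  (forall u, F u \in T <-> u \in S) ->
  exists phi : {linear quotmod S -> quotmod T}, bijective phi.
Proof.
move=> linF /choice[G FK] FS.
pose phi (x : quotmod S) : quotmod T := quot_pi T (F (quot_repr x)).
have FB u v : F (u - v) = F u - F v.
  by rewrite addrC -scaleN1r linF scaleN1r addrC.
have phiE u : phi (quot_pi S u) = quot_pi T (F u).
  apply/quot_piP; rewrite -FB; apply/FS/quot_piP; exact: quot_reprK.
have lin_phi : linear phi.
  move=> c x y; rewrite -[x]quot_reprK -[y]quot_reprK -linearP !phiE linF.
  by rewrite linearP.
pose phiL : {linear quotmod S -> quotmod T} :=
  HB.pack phi (GRing.isLinear.Build k _ _ *:%R phi lin_phi).
exists phiL; exists (fun y => quot_pi S (G (quot_repr y))) => [x|y].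
  apply: etrans (quot_reprK x); apply/quot_piP/FS; rewrite FB FK.
  by apply/quot_piP; rewrite quot_reprK.
by rewrite [LHS]phiE FK quot_reprK.
Qed.

End LinearAlgebra.

(** * Derivations on a free category *)

Section FreeCategory.
Variable Q : quiver.

Lemma freecat_ind (P : forall x y : freecat Q, hom x y -> Prop) :
  (forall x, P x x (idm x)) ->
  (forall x e (u : @hom (freecat Q) x (src e)), P _ _ u ->
     P _ _ (comp (arrow_hom e) u)) ->
  forall x y u, P x y u.
Proof.
move=> Pid Pcons x y [p]; elim: p y => [|e p IH] y pP.
  have xy := eqP pP; subst y.
  by rewrite (_ : exist _ _ _ = idm (x : freecat Q)) //; exact: val_inj.
have /andP[/eqP ey pP'] := pP; subst y.
rewrite (_ : exist _ _ _ = comp (arrow_hom e) (exist _ p pP' : @hom (freecat Q) x (src e))).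
  exact/Pcons/IH.
exact: val_inj.
Qed.

End FreeCategory.

Section Derivations.
Variables (k : fieldType) (Q : quiver) (N : lmodType (catalg k Q)).
Local Notation D := (Dtilde N).
Local Notation act u := (alg_act (N := N) (path_elt u)).

Lemma act_id (x : freecat Q) (m : kspace N) :
  m \in at_vertex x -> act (idm x) m = m.
Proof. by case/asboolP=> m' ->; rewrite -alg_actM path_eltM comp1m. Qed.

Lemma act_comp (x y z : freecat Q) (u : hom y z) (v : hom x y) m :
  act (comp u v) m = act u (act v m).
Proof. by rewrite -alg_actM path_eltM. Qed.

Lemma alg_actDl s t m : alg_act (N := N) (s + t) m = alg_act s m + alg_act t m.
Proof. exact: (scalerDl (m : N)). Qed.

Lemma alg_actBl s t m : alg_act (N := N) (s - t) m = alg_act s m - alg_act t m.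
Proof. exact: (scalerBl s t (m : N)). Qed.

Lemma alg_act0l m : alg_act (N := N) 0 m = 0.
Proof. exact: (scale0r (m : N)). Qed.

Lemma val_push (x y z : freecat Q) (u : hom y z) (v : hom x y) w
    (E : w = comp u v) (m : D (Mor v)) :
  submod_val (push D E m) = act u (submod_val m).
Proof. by []. Qed.

(** The target functor sends the pair [(id, v)] defining [v^*] to an identity. *)
Lemma val_pull (x y z : freecat Q) (u : hom y z) (v : hom x y) w
    (E : w = comp u v) (m : D (Mor u)) :
  submod_val (pull D E m) = submod_val m.
Proof. exact: act_id (submod_valP m). Qed.

(** As [v^*] is an identity, the Leibniz rule is that of a crossed homomorphism; stated in [N], it
    involves no types indexed by morphisms. *)
Lemma derivationE (d : cochain1 D) :
  derivation d <-> forall (x y z : freecat Q) (f : hom y z) (g : hom x y),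
    submod_val (d (Mor (comp f g))) =
      act f (submod_val (d (Mor g))) + submod_val (d (Mor f)).
Proof.
split=> dP x y z f g.
  by rewrite dP -[in RHS](val_pull (erefl (comp f g))).
by apply: val_inj; rewrite /= dP -[in LHS](val_pull (erefl (comp f g))).
Qed.

Lemma innerE (d : cochain1 D) :
  inner d <-> exists n : forall x : freecat Q, piC_ob N x,
    forall (x y : freecat Q) (f : hom x y), submod_val (d (Mor f)) =
      act f (submod_val (n x)) - submod_val (n y).
Proof.
split=> -[n nP]; exists n => x y f.
  by rewrite nP -[in RHS](val_pull (esym (comp1m f))).
by apply: val_inj; rewrite /= nP -[in LHS](val_pull (esym (comp1m f))).
Qed.

(** Both sides obey the Leibniz rule, so agreement on arrows propagates to all paths; in the
    inductive step the terms [e n_s(e)] cancel. *)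
Lemma derivation_inner (d : cochain1 D) (n : forall x : freecat Q, piC_ob N x) :
  derivation d ->
  (forall e, submod_val (d (arrow_mor e)) =
     act (arrow_hom e) (submod_val (n (src e))) - submod_val (n (tgt e))) ->
  inner d.
Proof.
move=> /derivationE dP dE; apply/innerE; exists n.
apply: freecat_ind => [x|x e u IH].
  rewrite act_id ?submod_valP // subrr.
  (* The Leibniz rule for [id id = id] reads [d(id) = d(id) + d(id)], hence [d(id) = 0]. *)
  have := dP _ _ _ (idm x) (idm x); rewrite comp1m act_id ?submod_valP //.
  by move/eqP; rewrite -subr_eq0 opprD addNKr oppr_eq0 => /eqP.
by rewrite dP IH dE linearB act_comp; exact: subrKA.
Qed.

Lemma derivation_ext (m : forall e : arrow Q, piC_ob N (tgt e)) :
  exists2 d : cochain1 D, derivation d & forall e, d (arrow_mor e) = m e.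
Proof.
(* The Leibniz rule forces the value [m(e_1) + e_1 m(e_2) + ... + e_1 ... e_{p-1} m(e_p)] on
   [e_1 ... e_p]; the fold is its Horner form. *)
pose dval := foldr
  (fun e x => act (arrow_hom e) x + submod_val (m e)) (0 : kspace N).
have dvalP (x y : freecat Q) (u : hom x y) : dval (val u) \in at_vertex y.
  elim/freecat_ind: u => {x y} [x|x e u IH] /=; first exact: rpred0.
  rewrite rpredD ?submod_valP //; apply/asboolP.
  by exists (act (arrow_hom e) (dval (val u))); rewrite -act_comp comp1m.
have dval_cat (x y z : freecat Q) (u : hom y z) (v : hom x y) :
    dval (val (comp u v)) = act u (dval (val v)) + dval (val u).
  elim/freecat_ind: u x v => {y z} [y|y e u IH] x v.
    by rewrite comp1m /= addr0 act_id ?dvalP.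
  rewrite act_comp; apply: etrans (esym (addrA _ _ _)).
  by rewrite -linearD -IH.
exists (fun u : mor (freecat Q) => Submod (dvalP _ _ (arr u))).
  by apply/derivationE => x y z u v; exact: dval_cat.
by move=> e; apply: val_inj; rewrite /= linear0 add0r.
Qed.

End Derivations.

(** * The forest and the enumerations produced by Algorithm A *)

Section AlgorithmA.
Variable Q : quiver.

(** Every pass recomputes all five variables from [Qb], so a case analysis on the last pass
    suffices. *)
Lemma loopA_inv (Pc Ph : {set vertex Q}) (Q1 Q2 Q3 : {set arrow Q}) :
  loopA Pc Ph Q1 Q2 Q3 ->
  [/\ Pc = tgt @: Q1, {in Q1 &, injective tgt}, Ph = ~: Pc,
      [disjoint Q1 & Q2] & Q3 = ~: (Q1 :|: Q2)].
Proof.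
case=> [|{}Pc {}Ph {}Q1 {}Q2 {}Q3 h Qb f _ _ _ _ Pc' fP Q1'].
  split; rewrite ?imset0 ?setC0 ?setU0 ?setC0 //.
    by move=> ? ?; rewrite inE.
  by rewrite disjoints_subset sub0set.
have tgtK : {in Pc', cancel f tgt} by move=> x /fP[].
split=> //.
- rewrite -imset_comp -[LHS]imset_id; apply: eq_in_imset => x /tgtK /= -> //.
- by move=> _ _ /imsetP[x xP ->] /imsetP[y yP ->]; rewrite !tgtK // => ->.
- by rewrite disjoint_sym disjoints_subset subsetDr.
have /setIidPr sQ1 : Q1' \subset Qb by apply/subsetP => _ /imsetP[x /fP[fQ _] ->].
by rewrite -{1}sQ1 setID.
Qed.

(** A vertex is peeled only when no remaining arrow starts at it, and the arrow ending at it leaves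
    with it, so targets are listed before sources. A source outside [Pc] has index [size a], which
    still exceeds the index of the target. *)
Lemma peelA_inv (Pc : {set vertex Q}) (Q1 : {set arrow Q}) a f :
  peelA Pc Q1 a f -> Pc = tgt @: Q1 -> {in Q1 &, injective tgt} ->
  [/\ uniq a, a =i Pc, f =i Q1 &
     {in Q1, forall e, (index (tgt e) a < index (src e) a)%N}].
Proof.
elim=> {Pc Q1 a f} [Q1|Pc Q1 x e a f xP /forall_inP xsrc eQ ex _ IH] PQ injQ.
  have Q10 : Q1 = set0 by apply/eqP; rewrite -(imset_eq0 tgt) -PQ.
  by split=> // y; rewrite ?Q10 !inE.
(* By injectivity [e] is the only arrow into [x], so removing [e] removes exactly [x] from the set
   of targets. *)
have tgtD : {in Q1, forall e', (tgt e' == x) = (e' == e)}.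
  by move=> e' e'Q; apply/eqP/eqP => [e'x|->//]; apply: injQ; rewrite ?ex.
have [| |ua aP fQ idx] := IH.
- apply/setP => y; rewrite PQ !inE; apply/andP/imsetP => [[yx /imsetP[e' e'Q ye]]|].
    by exists e' => //; rewrite !inE e'Q -tgtD // -ye yx.
  by case=> e'; rewrite !inE => /andP[ne e'Q] ->; rewrite tgtD // imset_f.
- by move=> u v /setD1P[_ uQ] /setD1P[_ vQ]; exact: injQ.
split=> [|y|y|e' e'Q].
- by rewrite /= aP !inE eqxx.
- by rewrite inE aP !inE; case: eqP => [->|].
- by rewrite inE fQ !inE; case: eqP => [->|].
rewrite /= !(eq_sym x) (negPf (xsrc _ e'Q)) tgtD //.
by case: eqP => // /eqP ne; apply: idx; rewrite !inE ne.
Qed.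

(** Together with [outputA_tgt], this is all that the rest of the proof takes from Algorithm A. *)
Lemma outputA_inv l m n r (a : l.-tuple (vertex Q)) (b : m.-tuple (vertex Q))
    (f : l.-tuple (arrow Q)) (g : n.-tuple (arrow Q)) (h : r.-tuple (arrow Q)) :
  outputA a b f g h ->
  [/\ uniq (a ++ b) /\ (forall x, x \in a ++ b),
      uniq ((f ++ g) ++ h) /\ (forall e, e \in (f ++ g) ++ h) &
      {in f, forall e, (index (tgt e) a < index (src e) a)%N}].
Proof.
case=> Pc [Ph [Q1 [Q2 [Q3]]]].
case=> -[/loopA_inv[PQ injQ PhE dis Q3E] _] peel [ub bP] [ug gQ] [uh hQ].
have [ua aP fQ idx] := peelA_inv peel PQ injQ.
have uf : uniq f by apply: (@map_uniq _ _ tgt); rewrite (peelA_tgt peel).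
split; last by move=> e; rewrite fQ; exact: idx.
  split=> [|x]; last by rewrite mem_cat aP bP PhE inE orbN.
  rewrite cat_uniq ua ub andbT; apply/hasPn => x.
  by rewrite bP PhE inE /= aP.
split=> [|e]; last first.
  by rewrite !mem_cat fQ gQ hQ Q3E !inE orbN.
rewrite !cat_uniq uf ug uh !andbT; apply/andP; split; apply/hasPn => e.
  by rewrite gQ /= fQ => eQ2; rewrite (disjointFl dis).
by rewrite hQ Q3E !inE mem_cat fQ gQ.
Qed.

End AlgorithmA.

(** * Paths in a forest and the elements [rho] *)

(* [rank] witnesses that [Q1] is acyclic; the order in which Algorithm A peels
   off the vertices provides one. *)
Section PathsInForest.
Variables (Q : quiver) (Q1 : {set arrow Q}) (rank : vertex Q -> nat).
Hypothesis tgt_inj : {in Q1 &, injective tgt}.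
Hypothesis rank_lt : {in Q1, forall e, (rank (src e) < rank (tgt e))%N}.

Lemma path_rank x y p : is_path x y p -> all (mem Q1) p -> (rank x <= rank y)%N.
Proof.
elim: p y => [|e p IH] y /= => [/eqP-> //|/andP[/eqP <- xp] /andP[eQ pQ]].
by apply: leq_trans (IH _ xp pQ) _; apply: ltnW; exact: rank_lt.
Qed.

(** Read back from [y], each arrow is forced because at most one arrow of [Q1] enters a vertex.
    Neither path can stop before the other, as the remainder would be a closed path, which [rank]
    excludes. *)
Lemma path_uniq x y p q : is_path x y p -> is_path x y q ->
  all (mem Q1) p -> all (mem Q1) q -> p = q.
Proof.
have nloop z e u : is_path z (src e) u -> e \in Q1 -> all (mem Q1) u ->
    tgt e <> z.
  move=> zu eQ uQ ez; have := leq_trans (rank_lt eQ) _.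
  by rewrite ez => /(_ _ (path_rank zu uQ)); rewrite ltnn.
elim: p q y => [|e p IH] [|e' q] y //=.
- move=> /eqP <- /andP[/eqP ex xq] _ /andP[eQ qQ].
  by case: (nloop _ _ _ xq eQ qQ).
- move=> /andP[/eqP ex xq] /eqP xy /andP[eQ qQ].
  by case: (nloop _ _ _ xq eQ qQ); rewrite ex.
move=> /andP[/eqP <- xp] /andP[/eqP ee xq] /andP[eQ pQ] /andP[e'Q qQ].
have E : e' = e by exact: tgt_inj.
by subst e'; congr cons; exact: IH xp xq pQ qQ.
Qed.

Variable k : fieldType.

(** The [R(c, y)] of the outline. *)
Definition reach (c y : freecat Q) : catalg k Q :=
  oapp path_elt 0 (path_in Q1 c y).

Lemma reach_path (c y : freecat Q) (p : path_hom c y) :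
  all (mem Q1) (val p) -> reach c y = path_elt (p : hom c y).
Proof.
move=> pQ; rewrite /reach /path_in; case: pselect => [H|[]]; last by exists p.
congr path_elt; apply: val_inj.
by apply: path_uniq (valP _) (valP p) _ pQ; exact: projT2 (cid H).
Qed.

Lemma reach0 (c y : freecat Q) :
  (forall p : path_hom c y, ~~ all (mem Q1) (val p)) -> reach c y = 0.
Proof.
by move=> np; rewrite /reach /path_in; case: pselect => // -[p]; move/negP: (np p).
Qed.

Lemma reach_root (c y : freecat Q) : y \notin tgt @: Q1 ->
  reach c y = if c == y :> vertex Q then path_elt (idm y) else 0.
Proof.
move=> yQ; case: eqP => [->|cy]; first exact: reach_path.
apply: reach0 => -[[|e p] /= pP]; first by case: cy; exact/eqP.
have /andP[/eqP ey _] := pP.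
by apply/negP => /andP[eQ _]; move: yQ; rewrite -ey imset_f.
Qed.

Lemma rhoE (c : freecat Q) e : rho k Q1 c e =
  reach c (tgt e) - path_elt (arrow_hom e) * reach c (src e).
Proof.
rewrite /rho /reach; congr (_ - _).
by case: path_in => [p|] /=; rewrite ?mulr0 ?path_eltM.
Qed.

(* If [e] is in [Q1], a nontrivial path of [Q1] ending at [tgt e] ends with [e],
   so the two terms of [rho] cancel unless the path is trivial. *)
Lemma rho_in (c : freecat Q) e : e \in Q1 -> rho k Q1 c e =
  if c == tgt e then path_elt (idm (tgt e : freecat Q)) else 0.
Proof.
move=> eQ; rewrite rhoE; apply/eqP; rewrite subr_eq; apply/eqP.
have [[p pQ]|np] := pselect (exists p : path_hom c (src e), all (mem Q1) (val p)).
  have /negPf -> : c != tgt e.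
    apply/negP => /eqP ce; have := path_rank (valP p) pQ.
    by rewrite leqNgt ce rank_lt.
  rewrite (reach_path pQ) path_eltM add0r.
  by apply: reach_path; rewrite /= eQ.
rewrite (reach0 (y := src e)); last first.
  by move=> p; apply/negP => pQ; apply: np; exists p.
rewrite mulr0 addr0; case: eqP => [->|ce]; first exact: reach_path.
apply: reach0 => -[[|e' p] /= pP]; first by case: ce; exact/eqP.
have /andP[/eqP ee pP'] := pP; apply/negP => /andP[e'Q pQ]; apply: np.
have E : e' = e by exact: tgt_inj.
by subst e'; exists (exist _ p pP').
Qed.

Variable N : lmodType (catalg k Q).
Local Notation act u := (alg_act (N := N) (path_elt u)).
Implicit Types n : forall x : freecat Q, piC_ob N x.

(** This inverts the unitriangular family [R]: take [xi_y = n_y] at a root, and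
    [xi_y = n_y - e n_s(e)] when [e] is the arrow of [Q1] into [y]. *)
Lemma reach_sum n : exists xi : forall c : freecat Q, piC_ob N c,
  forall y, submod_val (n y) =
    \sum_(c : vertex Q) alg_act (reach c y) (submod_val (xi c)) :> kspace N.
Proof.
pose isxi y (z : piC_ob N y) := (y \notin tgt @: Q1 -> z = n y) /\
  {in Q1, forall e, tgt e = y ->
     submod_val z = submod_val (n y) - act (arrow_hom e) (submod_val (n (src e)))}.
have /fin_all_exists[xi xiP] (y : vertex Q) : exists z, isxi y z.
  have [/imsetP[e eQ ->]|yQ] := boolP (y \in tgt @: Q1); last first.
    by exists (n y); split=> // e eQ ey; rewrite -ey imset_f in yQ.
  exists (n (tgt e) - piC_act (arrow_hom e) (n (src e))); split.
    by rewrite imset_f.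
  by move=> e' e'Q /(tgt_inj e'Q eQ) ->.
exists xi => y; have [d] := ubnP (rank y); elim: d y => // d IH y yd.
have [/imsetP[e eQ Ey]|yQ] := boolP (y \in tgt @: Q1).
  (* In the sum over [c], the [rho] part keeps only the term [c = y], which is [xi_y]; the other
     part is [e n_s(e)] by induction on the rank. *)
  have reachE (c : freecat Q) : reach c (tgt e) =
      rho k Q1 c e + path_elt (arrow_hom e) * reach c (src e).
    by rewrite rhoE subrK.
  subst y; under eq_bigr => c _ do rewrite reachE alg_actDl alg_actM.
  rewrite big_split -linear_sum -IH; last first.
    exact: leq_trans (rank_lt eQ) yd.
  rewrite (bigD1 (tgt e)) //= big1 => [|c /negPf ce]; last first.
    by rewrite rho_in // ce alg_act0l.
  rewrite addr0 rho_in // eqxx act_id ?submod_valP //.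
  have [_ /(_ e eQ erefl) ->] := xiP (tgt e); exact: esym (subrK _ _).
rewrite (bigD1 y) //= big1 => [|c /negPf ce]; last first.
  by rewrite reach_root // ce alg_act0l.
have [-> //] := xiP y.
by rewrite addr0 reach_root // eqxx act_id ?submod_valP.
Qed.

(** Expanding [n] by [reach_sum] yields the coefficients [e R(c, s(e)) - R(c, t(e)) = - rho(c, e)];
    the sign is absorbed into [xi]. *)
Lemma coboundary_rho n : exists xi : forall c : freecat Q, piC_ob N c,
  forall e, act (arrow_hom e) (submod_val (n (src e))) - submod_val (n (tgt e))
    = \sum_(c : vertex Q) alg_act (rho k Q1 c e) (submod_val (xi c)) :> kspace N.
Proof.
have [xi xiP] := reach_sum n; exists (fun c => - xi c) => e.
rewrite !xiP linear_sum -sumrB; apply: eq_bigr => c _.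
by rewrite rhoE linearN /= alg_actBl alg_actM opprB.
Qed.

Lemma rho_coboundary (c : freecat Q) (nu : kspace N) :
  exists n, forall e,
    act (arrow_hom e) (submod_val (n (src e))) - submod_val (n (tgt e))
      = alg_act (rho k Q1 c e) nu :> kspace N.
Proof.
(* The witness is [n_y = - R(c, y) nu]. *)
have nP y : alg_act (- reach c y) nu \in at_vertex y.
  apply/asboolP; exists (alg_act (- reach c y) nu); rewrite -alg_actM mulrN.
  congr (alg_act (- _) _); rewrite /reach.
  by case: path_in => [p|] /=; rewrite ?mulr0 // path_eltM comp1m.
exists (fun y => Submod (nP y)) => e.
by rewrite /= -alg_actM -alg_actBl mulrN opprK addrC -rhoE.
Qed.

End PathsInForest.

(** * Coordinates and evaluation of derivations on arrows *)

Section Coordinates.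
Variables (k : fieldType) (Q : quiver) (N : lmodType (catalg k Q)).
Variables (l n r : nat)
  (f : l.-tuple (arrow Q)) (g : n.-tuple (arrow Q)) (h : r.-tuple (arrow Q)).
Local Notation A := (A123 N f g h).

(** As entries of a single tuple, the row arrows inherit its uniqueness and exhaustiveness. *)
Lemma row_arrowE i : row_arrow f g h i = tnth [tuple of (f ++ g) ++ h] i.
Proof.
rewrite /row_arrow; case: (split_ordP i) => [i' ->|i3 ->].
  by rewrite tnth_lshift; case: (split_ordP i') => [i1 ->|i2 ->];
    rewrite ?tnth_lshift ?tnth_rshift.
by rewrite tnth_rshift.
Qed.

(** Retyping [coord] with values in [kspace N] lets it carry a [k]-linear structure. *)
Definition kcoord (i : 'I_(l + n + r)) (x : A) : kspace N := coord x i.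

Fact kcoord_linear i : linear (kcoord i).
Proof.
move=> c x y; rewrite /kcoord /coord; case: (split i) => // i'.
by case: (split i').
Qed.
HB.instance Definition _ i := GRing.isLinear.Build k A (kspace N) *:%R
  (kcoord i) (kcoord_linear i).

Lemma kcoord_inj (x y : A) : (forall i, kcoord i x = kcoord i y) -> x = y.
Proof.
case: x y => [[x1 x2] x3] [[y1 y2] y3] xy; congr (_, _, _);
  apply: functional_extensionality_dep => i; apply: val_inj.
- have := xy (lshift r (lshift n i)).
  by rewrite /kcoord /coord (unsplitK (inl (lshift n i))) (unsplitK (inl i)).
- have := xy (lshift r (rshift l i)).
  by rewrite /kcoord /coord (unsplitK (inl (rshift l i))) (unsplitK (inr i)).
by have := xy (rshift (l + n) i); rewrite /kcoord /coord (unsplitK (inr i)).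
Qed.

Lemma kcoord_at_vertex (x : A) i :
  kcoord i x \in at_vertex (tgt (row_arrow f g h i) : freecat Q).
Proof.
rewrite /kcoord /coord /row_arrow; case: (split i) => [i'|i3].
  by case: (split i') => ?; exact: submod_valP.
exact: submod_valP.
Qed.

Definition arrow_values (d : Der (Dtilde N)) : A :=
  (fun i => val d (arrow_mor (tnth f i)), fun i => val d (arrow_mor (tnth g i)),
   fun i => val d (arrow_mor (tnth h i))).

Lemma kcoord_arrow_values d i :
  kcoord i (arrow_values d) = submod_val (val d (arrow_mor (row_arrow f g h i))).
Proof.
rewrite /kcoord /coord /row_arrow; case: (split i) => // i'.
by case: (split i').
Qed.

Lemma arrow_values_linear : linear arrow_values.
Proof.
move=> c d e; apply: kcoord_inj => i; rewrite [LHS]kcoord_arrow_values.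
apply: etrans (esym (kcoord_linear i c _ _)).
rewrite !kcoord_arrow_values.
have -> : val (c *: d + e) = c *: val d + val e by exact: linearP.
by [].
Qed.

End Coordinates.

(** * The columns of [V] and [W] span the coboundaries *)

Section Columns.
Variables (k : fieldType) (Q : quiver).
Variables (l m n r : nat)
  (a : l.-tuple (vertex Q)) (b : m.-tuple (vertex Q))
  (f : l.-tuple (arrow Q)) (g : n.-tuple (arrow Q)) (h : r.-tuple (arrow Q)).
Hypothesis out : outputA a b f g h.
Local Notation Q1 := [set e in f].
Local Notation row := (row_arrow f g h).
(** Peeling lists targets before sources, so the index is reversed to make the rank grow along
    arrows; vertices outside [a] get rank [0]. *)
Local Notation rank := (fun x => size a - index x a)%N.

Let uniq_ab : uniq (a ++ b). Proof. by have [[]] := outputA_inv out. Qed.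
Let mem_ab x : x \in a ++ b. Proof. by have [[]] := outputA_inv out. Qed.

Lemma output_tgt_inj : {in Q1 &, injective tgt}.
Proof.
move=> e e'; rewrite !inE => /tnthP[i ->] /tnthP[j ->].
rewrite !(outputA_tgt out) => /(tuple_uniqP _ _) -> //.
by move: uniq_ab; rewrite cat_uniq => /and3P[].
Qed.

Lemma output_rank_lt : {in Q1, forall e, (rank (src e) < rank (tgt e))%N}.
Proof.
have [_ _ idx] := outputA_inv out.
move=> e; rewrite inE => /idx lt; rewrite ltn_sub2l //.
exact: leq_trans lt (index_size _ _).
Qed.

Lemma row_arrow_inj : injective row.
Proof.
have [_ [ue _] _] := outputA_inv out.
by move=> i j; rewrite !row_arrowE => /(tuple_uniqP _ ue).
Qed.

Lemma row_arrow_surj e : exists i, row i = e.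
Proof.
have [_ [_ me] _] := outputA_inv out.
by have /(tnthP [tuple of (f ++ g) ++ h])[i ->] := me e; exists i; rewrite row_arrowE.
Qed.

(** The identity block also has the form [rho]: this is [rho_in] on the rows of [f], whose targets
    are the [a_i]. *)
Lemma matV_rho i j : matV k a f g h i j = rho k Q1 (tnth a j) (row i).
Proof.
rewrite /row_arrow; case: (split_ordP i) => [i' ->|i3 ->].
  rewrite col_mxEu; case: (split_ordP i') => [i1 ->|i2 ->].
    rewrite col_mxEu mxE (rho_in output_tgt_inj output_rank_lt); last first.
      by rewrite inE mem_tnth.
    have /tuple_uniqP a_inj : uniq a.
      by move: uniq_ab; rewrite cat_uniq => /and3P[].
    by rewrite (outputA_tgt out) (inj_eq a_inj) eq_sym; case: eqP => // ->.
  by rewrite col_mxEd mxE.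
by rewrite col_mxEd mxE.
Qed.

(** On the rows of [f], [rho_in] gives [0] because [b_j] is none of the targets [a_i]. *)
Lemma matW_rho i j : matW k b f g h i j = rho k Q1 (tnth b j) (row i).
Proof.
rewrite /row_arrow; case: (split_ordP i) => [i' ->|i3 ->].
  rewrite col_mxEu; case: (split_ordP i') => [i1 ->|i2 ->].
    rewrite col_mxEu mxE (rho_in output_tgt_inj output_rank_lt); last first.
      by rewrite inE mem_tnth.
    rewrite (outputA_tgt out); case: eqP => // ba.
    have := uniq_ab; rewrite cat_uniq => /and3P[_ /hasPn/(_ _ (mem_tnth j b))].
    by rewrite /= ba mem_tnth.
  by rewrite col_mxEd mxE.
by rewrite col_mxEd mxE.
Qed.

Lemma sum_vertices (V : nmodType) (F : vertex Q -> V) :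
  \sum_x F x = \sum_(j < l) F (tnth a j) + \sum_(j < m) F (tnth b j).
Proof.
rewrite -(big_tuple _ _ a xpredT F) -(big_tuple _ _ b xpredT F) -big_cat [RHS]big_uniq //=.
by apply: eq_bigl => x; apply: esym; exact: mem_ab.
Qed.

Variable N : lmodType (catalg k Q).
Local Notation A := (A123 N f g h).
Local Notation act u := (alg_act (N := N) (path_elt u)).

Definition coboundary (x : A) :=
  exists nu : forall y : freecat Q, piC_ob N y, forall i,
    kcoord i x = act (arrow_hom (row i)) (submod_val (nu (src (row i))))
                 - submod_val (nu (tgt (row i))).

Lemma coboundary0 : coboundary 0.
Proof. by exists (fun=> 0) => i; do 2!rewrite linear0; exact: esym (subr0 _). Qed.

Lemma coboundaryZD c (x y : A) :
  coboundary x -> coboundary y -> coboundary (c *: x + y).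
Proof.
move=> [nu nuE] [mu muE]; exists (fun z => c *: nu z + mu z) => i.
by rewrite linearP /= nuE muE linearP scalerBr opprD addrACA.
Qed.

Lemma col_span_coboundary d (c : d.-tuple (vertex Q))
    (M : 'M[catalg k Q]_(l + n + r, d)) :
  (forall i j, M i j = rho k Q1 (tnth c j) (row i)) ->
  forall x : A, x \in col_span N f g h c M -> coboundary x.
Proof.
move=> ME; apply: span_ind coboundary0 coboundaryZD _ => x [j [nu [_ xE]]].
have [mu muE] := rho_coboundary Q1 (tnth c j) nu; exists mu => i.
by rewrite muE -ME; exact: xE.
Qed.

(** Since [a] and [b] together list each vertex once, the expansion of [coboundary_rho] over all
    vertices splits into a part in the span of [V] and one in that of [W]. *)
Lemma col_spans_coboundary (x : A) :
  x \in sumsub (col_span N f g h a (matV k a f g h))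
               (col_span N f g h b (matW k b f g h)) <-> coboundary x.
Proof.
split=> [/asboolP[s [t [sV tW ->]]]|[nu nuE]].
  rewrite -[s]scale1r; apply: (coboundaryZD 1).
    exact: (col_span_coboundary matV_rho).
  exact: (col_span_coboundary matW_rho).
have [xi xiE] := coboundary_rho output_tgt_inj output_rank_lt nu.
have /fin_all_exists[s sE] j := col_times_matV g h j
  (submod_val (xi (tnth a j))) (outputA_tgt out).
have /fin_all_exists[t tE] j := col_times_matW f g h b j
  (submod_val (xi (tnth b j))).
apply/asboolP; exists (\sum_j s j), (\sum_j t j); split.
- apply: rpred_sum => j _; apply: mem_span.
  by exists j, (submod_val (xi (tnth a j))); split; first exact: submod_valP.
- apply: rpred_sum => j _; apply: mem_span.
  by exists j, (submod_val (xi (tnth b j))); split; first exact: submod_valP.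
apply: kcoord_inj => i; rewrite nuE xiE sum_vertices linearD !linear_sum /=.
congr (_ + _); apply: eq_bigr => j _.
  by rewrite -matV_rho; apply: esym; exact: sE.
by rewrite -matW_rho; apply: esym; exact: tE.
Qed.

Lemma arrow_values_surj (x : A) : exists d, arrow_values f g h d = x.
Proof.
(* Coordinates are indexed by rows but [derivation_ext] wants values indexed by arrows; quantifying
   over the rows [i] with [row i = e] avoids a transport between fibres. *)
have /fin_all_exists[p pP] (e : arrow Q) : exists p : piC_ob N (tgt e),
    forall i, row i = e -> submod_val p = kcoord i x.
  have [i <-] := row_arrow_surj e; exists (Submod (kcoord_at_vertex x i)).
  by move=> j /row_arrow_inj ->.
have [d dP dE] := derivation_ext p.
have dDer : d \in is_der (D := Dtilde N) by exact/asboolP.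
exists (Submod dDer); apply: kcoord_inj => i.
by rewrite kcoord_arrow_values /= dE; exact: pP.
Qed.

Lemma arrow_values_inner d :
  arrow_values f g h d \in sumsub (col_span N f g h a (matV k a f g h))
                                 (col_span N f g h b (matW k b f g h)) <->
  d \in Ider (D := Dtilde N).
Proof.
rewrite col_spans_coboundary; split=> [[nu nuE]|/asboolP/innerE[nu nuE]].
  apply/asboolP/(derivation_inner (n := nu)); first exact/asboolP/(submod_valP d).
  by move=> e; have [i <-] := row_arrow_surj e; rewrite -nuE kcoord_arrow_values.
by exists nu => i; rewrite kcoord_arrow_values; exact: nuE.
Qed.

End Columns.

Theorem theorem3p1 (k : fieldType) (Q : quiver) (N : lmodType (catalg k Q))
    (l m n r : nat)
    (a : l.-tuple (vertex Q)) (b : m.-tuple (vertex Q))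
    (f : l.-tuple (arrow Q)) (g : n.-tuple (arrow Q)) (h : r.-tuple (arrow Q))
    (V : 'M[catalg k Q]_(l + n + r, l)) (W : 'M[catalg k Q]_(l + n + r, m)) :
  outputA a b f g h ->
  V = matV k a f g h -> W = matW k b f g h ->
  exists phi : {linear H1_BW (Dtilde N) ->
      quotmod (sumsub (col_span N f g h a V) (col_span N f g h b W))},
    bijective phi.
Proof.
move=> out -> ->; apply: (quotmod_iso (F := @arrow_values _ _ N _ _ _ f g h)).
- exact: arrow_values_linear.
- by move=> v; exact: (arrow_values_surj out v).
- by move=> d; exact: (arrow_values_inner out d).
Qed.
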